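(* Suppose $u\in V(\Omega)$, with $u=g$ on $\partial\Omega$, is the unique solution to a well-posed problem of the form: find $u$ such that $B(u,v)=F(v)$ for all $v\in V_0(\Omega)$. Consider the generalized Galerkin problem based on a Gaussian radial basis function (GRBF) discretization: find $u_h\in V_h\subset C_0^\infty(\mathbb{R}^d)$ such that $B_h(u_h,v_h)=F_h(v_h)$ for all $v_h\in V_h$, where $B_h$ and $F_h$ are such that $B_h(u_h,v_h)=B^\lambda(Tu_h,Tv_h)+B^c(u_h,v_h)$ and $F_h(v_h)=F^\lambda(Tv_h)+F^c(v_h)$. Then, provided this method is stable (i.e. the discrete solution operator $L_h^{-1}$ exists and is bounded, with stability constant $C_h=\|L_h^{-1}\|$), the error in the solution on $\Omega$ is bounded as $$\|u-Tu_h\|_{V(\Omega)}\le \left(1+C_h\|B^\lambda\|\right)\|u-T\pi_hu\|_{V(\Omega)}+C_h\,\varepsilon_{con}(\Omega^c).$$ In particular, the first term is bounded in terms of $\|B\|$, through $\|B^\lambda\|\le(1+C\lambda)\|B\|$, when there exists a trace inequality $\|w\|_{\partial\Omega}^2\le C\,B(w,w)$ for all $w \in V(\Omega)$.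
   Context: $\Omega\subset\mathbb{R}^d$ is a bounded domain, $\Omega^c=\mathbb{R}^d\setminus\Omega$. $V(\Omega)$, $V(\mathbb{R}^d)$, $V(\Omega^c)$ denote a Sobolev space of functions on the respective domain, with its norm; $V_g(\Omega)$ is the set of functions in $V(\Omega)$ equal to the given boundary datum $g$ on $\partial\Omega$, and $V_0(\Omega)$ is the case $g=0$. There is a bounded extension operator $E:V(\Omega)\to V(\mathbb{R}^d)$; its left inverse $T:V(\mathbb{R}^d)\to V(\Omega)$ is truncation (restriction to $\Omega$), with $\|T\|\le1$. $B:V(\Omega)\times V(\Omega)\to\mathbb{R}$ is a bounded bilinear form and $F:V(\Omega)\to\mathbb{R}$ a bounded linear functional, given by integration over $\Omega$. $V_h=\mathrm{span}\{\phi_1,\dots,\phi_n\}$, where $\phi_i(x)=(2\pi)^{-d/2}(\det C_i)^{-1/2}\exp(-\tfrac12(x-m_i)^\top C_i^{-1}(x-m_i))$ are Gaussian densities with means $m_i\in\mathbb{R}^d$ and covariances $C_i\in\mathbb{R}^{d\times d}$; here $C_0^\infty(\mathbb{R}^d)$ means smooth functions on $\mathbb{R}^d$ vanishing at infinity. $V_h$ carries the norm of $V(\mathbb{R}^d)$. With $\langle\langle a,b\rangle\rangle_{\partial\Omega}=\int_{\partial\Omega}ab$, $\|a\|_{\partial\Omega}^2=\langle\langle a,a\rangle\rangle_{\partial\Omega}$ and a penalty parameter $\lambda>0$, define on $V(\Omega)$: $B^\lambda(w,v)=B(w,v)+\lambda\langle\langle w,v\rangle\rangle_{\partial\Omega}$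 and $F^\lambda(v)=F(v)+\lambda\langle\langle g,v\rangle\rangle_{\partial\Omega}$. $B^c$, $F^c$ denote the remaining parts of $B_h$, $F_h$, which involve integration over $\Omega^c$. In the paper's setting it is used that $B^\lambda(u,v)=F^\lambda(v)$ whenever $B(u,v)=F(v)$ and $u\in V_g(\Omega)$. $L_h:V_h\to V_h^*$ is defined by $(L_hw_h)(v_h)=B_h(w_h,v_h)$, so the discrete problem is $L_hu_h=F_h$. $\pi_h:V(\Omega)\to V_h$ is a restriction mapping (e.g. GRBF interpolation). $\|B\|,\|B^\lambda\|$ are the norms of bilinear forms on $V(\Omega)$. Finally, $$\varepsilon_{con}(\Omega^c)=\sup_{v\in V(\Omega^c)}\frac{|B^c(\pi_hu,v)-F^c(v)|}{\|v\|}.$$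
   Formalization: The formal theorem also assumes B^λ(u,Tv_h)=F^λ(Tv_h) for all v_h in V_h (used in the paper's setting); testing only with V_0(Ω) does not give it, and without it the error bound can fail. The trace constant C is taken ≥ 0. *)

(* Defs.v *)
From HB Require Import structures.
From mathcomp Require Import all_boot all_order all_algebra.
From mathcomp Require Import all_classical all_reals all_analysis.

Set Implicit Arguments.
Unset Strict Implicit.
Unset Printing Implicit Defensive.

Import Order.TTheory GRing.Theory Num.Theory.
Import numFieldNormedType.Exports.

Local Open Scope classical_set_scope.
Local Open Scope ring_scope.

(* Outer measures from coverings: [tau] is the cost of a covering set.  The
   empty set costs nothing even when [tau set0] is not 0 (as for diam^0). *)
Section covering_outer_measure.
Context {R : realType} {T : pointedType}.
Variable tau : set T -> \bar R.
Local Open Scope ereal_scope.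

Definition cover_cost (A : set T) : \bar R :=
  if `[< A = set0 >] then 0 else tau A.

Definition cover_outer (A : set T) : \bar R :=
  ereal_inf [set \sum_(i <oo) cover_cost (F i) |
             F in [set F : (set T)^nat | A `<=` \bigcup_i F i]].

Hypothesis tau_ge0 : forall A, 0 <= tau A.

Let D := g_sigma_algebraType [set: set T].

Let cost0 : cover_cost set0 = 0.
Proof. by rewrite /cover_cost; case: asboolP. Qed.

Let cost_ge0 A : 0 <= cover_cost A.
Proof. by rewrite /cover_cost; case: asboolP. Qed.

Let cover_outerE : cover_outer = @mu_ext _ D R cover_cost.
Proof.
apply/funext => A; rewrite /cover_outer /mu_ext; congr ereal_inf.
apply/seteqP; split=> _ [F /= FA <-]; exists F => //.
- by split => // i; exact: sub_sigma_algebra.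
- by case: FA.
Qed.

Lemma cover_outer0 : cover_outer set0 = 0.
Proof. by rewrite cover_outerE; exact: mu_ext0. Qed.

Lemma cover_outer_ge0 A : 0 <= cover_outer A.
Proof. by rewrite cover_outerE; exact: mu_ext_ge0. Qed.

Lemma le_cover_outer : {homo cover_outer : A B / A `<=` B >-> A <= B}.
Proof. by move=> A B AB; rewrite cover_outerE; exact: (@le_mu_ext _ D R). Qed.

Lemma cover_outer_sigma_subadditive : sigma_subadditive cover_outer.
Proof.
by move=> F; rewrite cover_outerE; exact: (@mu_ext_sigma_subadditive _ D R).
Qed.

End covering_outer_measure.

Section lebesgue_Rd.
Context (R : realType) (d : nat).
Implicit Types (a b : 'rV[R]_d).
Local Open Scope ereal_scope.

Definition box a b : set 'rV[R]_d :=
  [set x | forall j, (a ord0 j < x ord0 j <= b ord0 j)%R].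

Definition box_cost (A : set 'rV[R]_d) : \bar R :=
  ereal_inf [set (\prod_j (ab.2 ord0 j - ab.1 ord0 j))%R%:E |
    ab in [set ab : 'rV[R]_d * 'rV[R]_d |
      (forall j, (ab.1 ord0 j <= ab.2 ord0 j)%R) /\ A = box ab.1 ab.2]].

Lemma box_cost_ge0 A : 0 <= box_cost A.
Proof.
apply: le_ereal_inf_tmp => _ [[a b] /= [ab _] <-].
by rewrite lee_fin prodr_ge0// => j _; rewrite subr_ge0.
Qed.

Definition lebesgue_outer : set 'rV[R]_d -> \bar R := cover_outer box_cost.

HB.instance Definition _ := isOuterMeasure.Build R 'rV[R]_d lebesgue_outer
  (cover_outer0 box_cost_ge0) (cover_outer_ge0 box_cost_ge0)
  (@le_cover_outer _ _ box_cost) (cover_outer_sigma_subadditive box_cost_ge0).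

End lebesgue_Rd.

(* R^d with the sigma-algebra of Lebesgue measurable sets *)
Notation leb_space R d := (caratheodory_type (@lebesgue_outer R d)).

Definition leb (R : realType) (d : nat) : set (leb_space R d) -> \bar R :=
  @lebesgue_outer R d.
Arguments leb : clear implicits.

HB.instance Definition _ (R : realType) (d : nat) := isMeasure.Build _ _ _
  (leb R d)
  (@caratheodory_measure0 _ _ (@lebesgue_outer R d))
  (@caratheodory_measure_ge0 _ _ (@lebesgue_outer R d))
  (@caratheodory_measure_sigma_additive _ _ (@lebesgue_outer R d)).

Section hausdorff.
Context (R : realType) (d : nat).
Local Open Scope ereal_scope.

Definition euclidean_dist (x y : 'rV[R]_d) : R :=
  Num.sqrt (\sum_j (x ord0 j - y ord0 j) ^+ 2)%R.

Definition diam (A : set 'rV[R]_d) : \bar R :=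
  ereal_sup [set (euclidean_dist xy.1 xy.2)%:E | xy in A `*` A].

(* Volume of the Euclidean unit ball of R^s. *)
Fixpoint unit_ball_volume (s : nat) : R :=
  match s with
  | 0 => 1
  | 1 => 2
  | (s'.+1 as s1).+1 => (2 * pi / s1.+1%:R * unit_ball_volume s')%R
  end.

Lemma unit_ball_volume_ge0 s : (0 <= unit_ball_volume s)%R.
Proof.
suff : (0 <= unit_ball_volume s)%R /\ (0 <= unit_ball_volume s.+1)%R by case.
elim: s => [|s [IH1 IH2]]; first by split.
split=> //; apply: mulr_ge0 => //.
by rewrite divr_ge0// mulr_ge0// pi_ge0.
Qed.

(* The factor makes the s-dimensional Hausdorff measure agree with the
   s-dimensional area of smooth surfaces. *)
Definition hausdorff_cost (s : nat) (delta : R) (A : set 'rV[R]_d) : \bar R :=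
  if diam A <= delta%:E
  then (unit_ball_volume s * (fine (diam A) / 2) ^+ s)%R%:E else +oo.

Lemma diam_ge0 A : (0 <= fine (diam A))%R.
Proof.
have [->|/set0P[x Ax]] := eqVneq A set0.
  by rewrite /diam setX0 image_set0 ereal_sup0.
rewrite fine_ge0//; apply: le_ereal_sup_tmp.
by exists (euclidean_dist x x)%:E; [exists (x, x)|rewrite lee_fin sqrtr_ge0].
Qed.

Lemma hausdorff_cost_ge0 s delta A : 0 <= hausdorff_cost s delta A.
Proof.
rewrite /hausdorff_cost; case: ifPn => // _.
by rewrite lee_fin mulr_ge0 ?unit_ball_volume_ge0// exprn_ge0// divr_ge0// diam_ge0.
Qed.

Definition hausdorff_outer (s : nat) (A : set 'rV[R]_d) : \bar R :=
  ereal_sup [set cover_outer (hausdorff_cost s delta) A |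
             delta in [set delta : R | (0 < delta)%R]].

Lemma hausdorff_outer_ge0 s A : 0 <= hausdorff_outer s A.
Proof.
apply: le_ereal_sup_tmp; exists (cover_outer (hausdorff_cost s 1) A).
  by exists 1%R => //=.
by apply: cover_outer_ge0 => B; exact: hausdorff_cost_ge0.
Qed.

Lemma hausdorff_outer0 s : hausdorff_outer s set0 = 0.
Proof.
apply/eqP; rewrite eq_le hausdorff_outer_ge0 andbT.
apply: ge_ereal_sup => _ [delta /= _ <-].
by rewrite cover_outer0// => B; exact: hausdorff_cost_ge0.
Qed.

Lemma le_hausdorff_outer s :
  {homo hausdorff_outer s : A B / A `<=` B >-> A <= B}.
Proof.
move=> A B AB; apply: ge_ereal_sup => _ [delta /= d0 <-].
apply: le_ereal_sup_tmp; exists (cover_outer (hausdorff_cost s delta) B).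
  by exists delta.
exact: le_cover_outer.
Qed.

Lemma hausdorff_outer_sigma_subadditive s :
  sigma_subadditive (hausdorff_outer s).
Proof.
move=> F; apply: ge_ereal_sup => _ [delta /= d0 <-].
apply: (le_trans (cover_outer_sigma_subadditive _ _)).
  by move=> C; exact: hausdorff_cost_ge0.
apply: lee_nneseries => [i _ _|i _].
  by apply: cover_outer_ge0 => C; exact: hausdorff_cost_ge0.
by apply: ereal_sup_ubound; exists delta.
Qed.

End hausdorff.

Section surface_measure.
Context (R : realType) (d : nat) (Omega : set 'rV[R]_d).
Local Open Scope ereal_scope.

Definition bdry : set 'rV[R]_d := closure Omega `\` interior Omega.

(* (d-1)-dimensional Hausdorff measure restricted to the boundary: integrals
   against it over the whole space are integrals over the boundary. *)
Definition surface_outer (A : set 'rV[R]_d) : \bar R :=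
  hausdorff_outer d.-1 (A `&` bdry).

Lemma surface_outer0 : surface_outer set0 = 0.
Proof. by rewrite /surface_outer set0I hausdorff_outer0. Qed.

Lemma surface_outer_ge0 A : 0 <= surface_outer A.
Proof. exact: hausdorff_outer_ge0. Qed.

Lemma le_surface_outer : {homo surface_outer : A B / A `<=` B >-> A <= B}.
Proof. by move=> A B AB; apply: le_hausdorff_outer; exact: setSI. Qed.

Lemma surface_outer_sigma_subadditive : sigma_subadditive surface_outer.
Proof.
move=> F; rewrite /surface_outer setI_bigcupl.
exact: hausdorff_outer_sigma_subadditive.
Qed.

HB.instance Definition _ := isOuterMeasure.Build R 'rV[R]_d surface_outer
  surface_outer0 surface_outer_ge0 le_surface_outer
  surface_outer_sigma_subadditive.

End surface_measure.

Notation surf_space Omega := (caratheodory_type (surface_outer Omega)).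

Definition surf (R : realType) (d : nat) (Omega : set 'rV[R]_d) :
  set (surf_space Omega) -> \bar R := surface_outer Omega.
Arguments surf {R d} Omega.

HB.instance Definition _ (R : realType) (d : nat) (Omega : set 'rV[R]_d) :=
  isMeasure.Build _ _ _ (surf Omega)
  (@caratheodory_measure0 _ _ (surface_outer Omega))
  (@caratheodory_measure_ge0 _ _ (surface_outer Omega))
  (@caratheodory_measure_sigma_additive _ _ (surface_outer Omega)).

Section sobolev.
Context {R : realType} {d : nat}.
Notation Rd := 'rV[R]_d.
Implicit Types (D K : set Rd) (f g phi : Rd -> R) (s : seq 'I_d).

Definition partials s f : Rd -> R :=
  foldr (fun (i : 'I_d) h => fun x => 'D_(delta_mx ord0 i) h x) f s.

Definition smooth f := forall s, continuous (partials s f) /\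
  forall x i, derivable (partials s f) x (delta_mx ord0 i).

Definition test_function D phi := smooth phi /\
  exists K, [/\ compact K, K `<=` D & forall x, ~ K x -> phi x = 0].

(* Multi-indices of order at most k; each entry is then at most k. *)
Definition multi_index k := {alpha : {ffun 'I_d -> 'I_k.+1} |
  (\sum_i alpha i <= k)%N}.

Definition mi_order k (alpha : multi_index k) : nat := (\sum_i val alpha i)%N.

Definition mderiv k (alpha : multi_index k) f : Rd -> R :=
  partials (flatten [seq nseq (val alpha i) i | i <- enum 'I_d]) f.

Definition weak_derivative k (alpha : multi_index k) D f g :=
  forall phi, test_function D phi ->
    \int[leb R d]_(x in D) (f x * mderiv alpha phi x) =
    (-1) ^+ mi_order alpha * \int[leb R d]_(x in D) (g x * phi x).

(* Elements of L^p(D) and W^{k,p}(D) are represented by functions on R^d whose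
   values outside D are irrelevant. *)
Definition Lp (p : R) D f :=
  ((f \_ D : leb_space R d -> R) \in Lfun (leb R d) p%:E).

Definition Lp_norm (p : R) D f : R :=
  fine ('N[leb R d]_p%:E[EFin \o (f \_ D)])%E.

(* [g] lists weak derivatives of [f], with [f] itself at order 0. *)
Definition weak_derivatives (k : nat) (p : R) D f
    (g : multi_index k -> Rd -> R) :=
  forall alpha, [/\ Lp p D (g alpha), weak_derivative alpha D f (g alpha) &
    mi_order alpha = 0%N -> g alpha = f].

Definition sobolev k p D : set (Rd -> R) :=
  [set f | exists g : multi_index k -> Rd -> R, weak_derivatives p D f g].

(* Weak derivatives on an open set are unique almost everywhere, so the
   infimum is over a single value. *)
Definition sobolev_norm k p D f : R :=
  inf [set (\sum_alpha (Lp_norm p D (g alpha)) `^ p) `^ p^-1 |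
       g in [set g : multi_index k -> Rd -> R | weak_derivatives p D f g]].

End sobolev.

Arguments Lp {R d} p D f.
Arguments sobolev {R d} k p D.
Arguments sobolev_norm {R d} k p D f.

Section forms.
Context {R : realType} {X : Type}.
Notation fun_space := (X -> R).
Implicit Types (V W : set fun_space) (N : fun_space -> R) (F : fun_space -> R).
Implicit Types (B : fun_space -> fun_space -> R).

Definition linear_on V F := forall (a : R) w v, V w -> V v ->
  F (fun x => a * w x + v x) = a * F w + F v.

Definition bilinear_on V W B :=
  (forall w, V w -> linear_on W (B w)) /\
  (forall v, W v -> linear_on V (fun w => B w v)).

Definition functional_bounds V N F := [set M : R | 0 <= M /\
  forall v, V v -> `|F v| <= M * N v].

Definition dual V N : set (fun_space -> R) :=
  [set F | linear_on V F /\ functional_bounds V N F !=set0].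

Definition dual_norm V N F : R := inf (functional_bounds V N F).

Definition form_bounds V N B := [set M : R | 0 <= M /\
  forall w v, V w -> V v -> `|B w v| <= M * N w * N v].

Definition bounded_bilinear V N B :=
  bilinear_on V V B /\ form_bounds V N B !=set0.

Definition form_norm V N B : R := inf (form_bounds V N B).

(* For a form [B] on [V], the operator L : V -> V^* is [w |-> B w].  [S] is its
   inverse; functionals are identified when they agree on [V]. *)
Definition inverse_operator V N B (S : (fun_space -> R) -> fun_space) :=
  [/\ forall w, V w -> dual V N (B w),
      forall F, dual V N F -> V (S F) /\ forall v, V v -> B (S F) v = F v &
      forall F w, dual V N F -> V w -> (forall v, V v -> B w v = F v) ->
        S F = w].

Definition operator_bounds V N (S : (fun_space -> R) -> fun_space) :=
  [set C : R | 0 <= C /\ forall F, dual V N F -> N (S F) <= C * dual_norm V N F].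

Definition operator_norm V N S : R := inf (operator_bounds V N S).

End forms.

Section boundary_value_problem.
Context {R : realType} {d : nat}.
Notation Rd := 'rV[R]_d.
Variables (k : nat) (p : R) (Omega : set Rd).

Notation V := (sobolev k p Omega).
Notation normV := (sobolev_norm k p Omega).

Definition bounded_domain := [/\ open Omega, connected Omega, Omega !=set0 &
  bounded_set Omega].

Definition truncation (v : Rd -> R) : Rd -> R := v \_ Omega.

Definition extension_operator (E : (Rd -> R) -> (Rd -> R)) :=
  [/\ forall w, V w -> sobolev k p setT (E w),
      forall (a : R) w v, V w -> V v ->
        ae_eq (leb R d) setT (E (fun x => a * w x + v x))
                             (fun x => a * E w x + E v x),
      exists K : R, forall w, V w -> sobolev_norm k p setT (E w) <= K * normV w &
      forall w, V w -> ae_eq (leb R d) Omega (truncation (E w)) w].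

(* The complement is represented by its interior, an open set, on which a
   Sobolev space makes sense. *)
Definition exterior : set Rd := interior (~` Omega).

Definition bdry_L2 (a : Rd -> R) :=
  ((a : surf_space Omega -> R) \in Lfun (surf Omega) 2%:E).

Definition bdry_eq (a b : Rd -> R) := ae_eq (surf Omega) setT a b.

Definition bdry_dot (a b : Rd -> R) : R := \int[surf Omega]_x (a x * b x).

Definition bdry_norm (a : Rd -> R) : R := Num.sqrt (bdry_dot a a).

(* [gamma w] is the boundary value of the Sobolev function [w]. *)
Definition trace_operator (gamma : (Rd -> R) -> (Rd -> R)) :=
  [/\ forall w, V w -> bdry_L2 (gamma w),
      forall (a : R) w v, V w -> V v ->
        bdry_eq (gamma (fun x => a * w x + v x))
                (fun x => a * gamma w x + gamma v x),
      exists K : R, forall w, V w -> bdry_norm (gamma w) <= K * normV w &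
      forall w, V w -> {within closure Omega, continuous w} ->
        bdry_eq (gamma w) w].

Section trace.
Variable gamma : (Rd -> R) -> (Rd -> R).

Definition V_datum (g : Rd -> R) : set (Rd -> R) :=
  [set v | V v /\ bdry_eq (gamma v) g].

Definition V_zero : set (Rd -> R) := V_datum (fun=> 0).

Definition weak_solution (B : (Rd -> R) -> (Rd -> R) -> R)
    (F : (Rd -> R) -> R) (g u : Rd -> R) :=
  V_datum g u /\ forall v, V_zero v -> B u v = F v.

Definition unique_weak_solution B F g u := weak_solution B F g u /\
  forall u', weak_solution B F g u' -> ae_eq (leb R d) Omega u' u.

(* Hadamard well-posedness; boundary data range over the traces of V, measured
   through their liftings G. *)
Definition well_posed B := exists K : R,
  forall F G, dual V normV F -> V G ->
    exists2 u, unique_weak_solution B F (gamma G) u &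
      normV u <= K * (dual_norm V normV F + normV G).

Definition penalized_form (lambda : R) B (w v : Rd -> R) : R :=
  B w v + lambda * bdry_dot (gamma w) (gamma v).

Definition penalized_functional (lambda : R) F (g v : Rd -> R) : R :=
  F v + lambda * bdry_dot g (gamma v).

End trace.

(* [Bc] takes a discrete function on R^d and a function of V(Omega^c). *)
Definition generalized_form (Bl Bc : (Rd -> R) -> (Rd -> R) -> R)
    (w v : Rd -> R) : R :=
  Bl (truncation w) (truncation v) + Bc w (v \_ exterior).

Definition generalized_functional (Fl Fc : (Rd -> R) -> R) (v : Rd -> R) : R :=
  Fl (truncation v) + Fc (v \_ exterior).

(* Well defined on V(Omega^c), whose elements are functions up to equality
   almost everywhere. *)
Definition ae_invariant (F : (Rd -> R) -> R) := forall v v',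
  sobolev k p exterior v -> sobolev k p exterior v' ->
  ae_eq (leb R d) exterior v v' -> F v = F v'.

Definition consistency_error (Bc : (Rd -> R) -> (Rd -> R) -> R)
    (Fc : (Rd -> R) -> R) (w : Rd -> R) : \bar R :=
  ereal_sup [set (`|Bc w v - Fc v| / sobolev_norm k p exterior v)%:E |
             v in sobolev k p exterior].

End boundary_value_problem.

Section grbf.
Context {R : realType} {d : nat}.

Definition covariance_matrix (C : 'M[R]_d) := C^T = C /\
  forall x : 'rV[R]_d, x != 0 -> 0 < (x *m C *m x^T) ord0 ord0.

Definition gaussian (m : 'rV[R]_d) (C : 'M[R]_d) (x : 'rV[R]_d) : R :=
  (2 * pi) `^ (- (d%:R / 2)) * (\det C) `^ (- 2^-1) *
  expR (- (2^-1 * ((x - m) *m invmx C *m (x - m)^T) ord0 ord0)).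

Definition grbf_space n (m : 'I_n -> 'rV[R]_d) (C : 'I_n -> 'M[R]_d) :
  set ('rV[R]_d -> R) :=
  [set w | exists c : 'I_n -> R,
    w = fun x => \sum_i c i * gaussian (m i) (C i) x].

End grbf.

(* Main.v *)
Require Import Defs.
From HB Require Import structures.
From mathcomp Require Import all_boot all_order all_algebra.
From mathcomp Require Import all_classical all_reals all_analysis.
From mathcomp Require Import measurable_realfun.
From mathcomp Require Import ring lra.

(** The discrete error e = pi_h u - u_h lies in V_h, so stability bounds its
    norm by C_h times the dual norm of L_h e.  The exact solution satisfies
    B^lambda(u, T v) = F^lambda(T v) for v in V_h; subtracting the discrete
    problem therefore leaves

      B_h(e, v) = - B^lambda(u - T pi_h u, T v) + (B^c(pi_h u, v) - F^c(v)).

    Restriction to Omega or to its exterior does not increase the Sobolev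
    norm, so the right-hand side is at most
    (||B^lambda|| ||u - T pi_h u|| + eps_con) ||v||, and the error bound is the
    triangle inequality for u - T u_h = (u - T pi_h u) + T e.  The bound on
    ||B^lambda|| is Cauchy-Schwarz on the boundary followed by the trace
    inequality, which turns boundary norms into diagonal values of B.

    The analytic content is that W^{k,p} is a vector space ([sobolev_lin]) with
    a subadditive norm ([sobolev_normD]) that restriction to open sets does not
    increase ([sobolev_norm_restrict]).  The norm is an infimum over families
    of weak derivatives, so each inequality is shown for fixed families by
    Minkowski, in L^p and then in l^p, and passed to the infimum.  That a sum
    of families is a family of the sum requires splitting integrals
    of f times a derivative of a test function, hence their integrability, hence
    measurability of continuous functions for the Lebesgue outer measure
    ([leb_open_measurable]).  This comes down to half-spaces being Caratheodory
    measurable: a coordinate hyperplane cuts a box into two boxes whose volumes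
    add up.

    Two conventions need care.  The consistency error divides by ||v||, and a
    quotient by 0 is 0; when ||v|| = 0, v vanishes almost everywhere and both
    functionals vanish on it ([consistency_bound]).  The consistency error may
    be infinite; if moreover C_h = 0 then the product C_h * eps_con is 0, and
    stability makes the norm of e equal to 0. *)

Set Implicit Arguments.
Unset Strict Implicit.
Unset Printing Implicit Defensive.

Import Order.TTheory GRing.Theory Num.Theory.
Import numFieldNormedType.Exports.

Local Open Scope classical_set_scope.
Local Open Scope ring_scope.

(** * Caratheodory measurability for covering outer measures *)

Section covering_splitting.
Context {R : realType} {T : pointedType}.
Variable tau : set T -> \bar R.
Hypothesis tau_ge0 : forall A, (0 <= tau A)%E.

Lemma cover_cost_ge0 A : (0 <= cover_cost tau A)%E.
Proof. by rewrite /cover_cost; case: asboolP. Qed.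

Lemma cover_cost_le A : (cover_cost tau A <= tau A)%E.
Proof. by rewrite /cover_cost; case: asboolP. Qed.

Lemma cover_outer_le A : (cover_outer tau A <= tau A)%E.
Proof.
apply: ge_ereal_inf; exists (\sum_(i <oo) cover_cost tau (bigcup2 A set0 i))%E.
  by exists (bigcup2 A set0) => //= x Ax; exists 0%N.
rewrite (@nneseries_recl _ xpredT)//; last by move=> *; exact: cover_cost_ge0.
rewrite (@eseries_cond _ _ _ 1%N) eseries0 ?adde0 ?cover_cost_le//.
by case=> [|[|n]]//= _ _; rewrite /cover_cost; case: asboolP.
Qed.

(** Cutting each set of a covering of [X] by [S] yields coverings of the two
    pieces of [X], at no greater total cost. *)
Lemma cover_outer_split (S X : set T) :
  (forall A, tau (A `&` S) + tau (A `&` ~` S) <= tau A)%E ->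
  (cover_outer tau (X `&` S) + cover_outer tau (X `&` ~` S)
    <= cover_outer tau X)%E.
Proof.
move=> splitS; apply: le_ereal_inf_tmp => _ [F /= XF <-].
have cost_split A : (cover_cost tau (A `&` S) + cover_cost tau (A `&` ~` S)
    <= cover_cost tau A)%E.
  rewrite [leRHS]/cover_cost; case: asboolP => [->|_].
    by rewrite !set0I /cover_cost; case: asboolP => // _; rewrite adde0.
  by apply: le_trans (splitS A); apply: leeD; exact: cover_cost_le.
apply: (@le_trans _ _ (\sum_(i <oo) (cover_cost tau (F i `&` S) +
                                     cover_cost tau (F i `&` ~` S)))%E).
  rewrite nneseriesD; try by move=> *; exact: cover_cost_ge0.
  apply: leeD; apply: ereal_inf_lbound.
  - exists (fun i => F i `&` S) => //= x [/XF[i _ Fx] Sx].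
    by exists i.
  - exists (fun i => F i `&` ~` S) => //= x [/XF[i _ Fx] Sx].
    by exists i.
apply: lee_nneseries => // i _ _.
by apply: adde_ge0; exact: cover_cost_ge0.
Qed.

End covering_splitting.

(** * Lebesgue measurability of open sets and continuous functions *)

Section lebesgue_measurability.
Context {R : realType} {d : nat}.
Implicit Types (a b x : 'rV[R]_d).

(** The height, moved into the [j]-th side of the box, at which the hyperplane
    of equation x_j = c cuts it; with it the cut pieces are boxes even when the
    hyperplane misses the box. *)
Definition clamp_coord a b (j : 'I_d) (c : R) : R :=
  Num.max (a ord0 j) (Num.min (b ord0 j) c).

Definition set_coord a (j : 'I_d) (t : R) : 'rV[R]_d :=
  \row_i if i == j then t else a ord0 i.

Lemma box_lower_half a b j c : (forall i, a ord0 i <= b ord0 i) ->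
  box a b `&` [set x | x ord0 j <= c] =
  box a (set_coord b j (clamp_coord a b j c)).
Proof.
move=> ab; apply/seteqP; split=> [x [/= xab xc] i|x xab].
  rewrite mxE; case: eqP => [->|_]; last exact: xab.
  have /andP[-> xb] /= := xab j.
  by rewrite /clamp_coord le_max le_min xb xc orbT.
have := xab j; rewrite mxE eqxx /clamp_coord le_max le_min.
move=> /andP[ax]; rewrite leNgt ax /= => /andP[xb xc]; split => // i.
have := xab i; rewrite mxE; case: eqP => // -> _; by rewrite ax.
Qed.

Lemma box_upper_half a b j c : (forall i, a ord0 i <= b ord0 i) ->
  box a b `&` ~` [set x | x ord0 j <= c] =
  box (set_coord a j (clamp_coord a b j c)) b.
Proof.
move=> ab; apply/seteqP; split=> [x [/= xab /negP xc] i|x xab].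
  rewrite mxE; case: eqP => [->|_]; last exact: xab.
  have /andP[ax ->] /= := xab j.
  by rewrite /clamp_coord gt_max ax gt_min (ltNge c) xc orbT.
have := xab j; rewrite mxE eqxx /clamp_coord gt_max gt_min.
move=> /andP[/andP[ax] +] xb; rewrite ltNge xb /= => cx; split.
  move=> i; have := xab i; rewrite mxE; case: eqP => // -> _.
  by rewrite ax.
by apply/negP; rewrite -ltNge.
Qed.

(** Only the factor of the [j]-th side changes, and the two lengths add up to
    the original one. *)
Lemma box_cost_split (j : 'I_d) (c : R) (A : set 'rV[R]_d) :
  (box_cost (A `&` [set x | (x ord0 j <= c)%R]) +
   box_cost (A `&` ~` [set x | (x ord0 j <= c)%R]) <= box_cost A)%E.
Proof.
apply: le_ereal_inf_tmp => _ [[a b] /= [ab ->] <-].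
rewrite box_lower_half// box_upper_half//; set t := clamp_coord a b j c.
have at_ : a ord0 j <= t by rewrite le_max lexx.
have tb : t <= b ord0 j by rewrite ge_max ab ge_min lexx.
apply: (@le_trans _ _
  ((\prod_i (set_coord b j t ord0 i - a ord0 i))%:E +
   (\prod_i (b ord0 i - set_coord a j t ord0 i))%:E)%E).
  apply: leeD; apply: ereal_inf_lbound.
  - exists (a, set_coord b j t) => //=; split=> // i.
    by rewrite mxE; case: eqP => [->|].
  - exists (set_coord a j t, b) => //=; split=> // i.
    by rewrite mxE; case: eqP => [->|].
rewrite -EFinD lee_fin (bigD1 j)//= [X in _ + X](bigD1 j)//=.
rewrite [leRHS](bigD1 j)//= !mxE eqxx.
under eq_bigr => i /negbTE ij do rewrite mxE ij.
under [X in _ + (_ * X)]eq_bigr => i /negbTE ij do rewrite mxE ij.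
by rewrite -mulrDl addrC addrA subrK.
Qed.

Lemma lower_half_measurable (j : 'I_d) (c : R) :
  measurable ([set x | x ord0 j <= c] : set (leb_space R d)).
Proof.
apply: le_caratheodory_measurable => X.
exact/cover_outer_split/box_cost_split/box_cost_ge0.
Qed.

Lemma coord_measurable (j : 'I_d) :
  measurable_fun setT ((fun x => x ord0 j) : leb_space R d -> R).
Proof.
apply: (measurability _ (RGenOInfty.measurableE R)).
move=> /= _ [_] [c] -> <-; rewrite setTI.
rewrite (_ : _ @^-1` _ =
    ~` ([set x | x ord0 j <= c] : set (leb_space R d))).
  exact/measurableC/lower_half_measurable.
by apply/seteqP; split=> x /=; rewrite in_itv/= andbT ltNge => /negP.
Qed.

Lemma leb_ball_measurable (q : 'rV[R]_d) (r : R) :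
  measurable ([set x : 'rV[R]_d | forall j, `|q ord0 j - x ord0 j| < r]
    : set (leb_space R d)).
Proof.
rewrite (_ : mkset _ = \bigcap_(j in [set: 'I_d])
    [set x : leb_space R d | `|q ord0 j - x ord0 j| < r]); last first.
  by apply/seteqP; split=> x /= xq j => [_|]; exact: xq.
apply: fin_bigcap_measurable => [|j _]; first exact: finite_finset.
rewrite (_ : mkset _ = setT `&`
    (fun x : leb_space R d => q ord0 j - x ord0 j) @^-1` `]- r, r[); last first.
  by rewrite setTI; apply/seteqP; split=> x /=; rewrite in_itv/= -ltr_norml.
have mq : measurable_fun setT (fun x : leb_space R d => q ord0 j - x ord0 j).
  by apply: measurable_funB; [exact: measurable_cst|exact: coord_measurable].
exact: mq.
Qed.

(** An open set is the countable union of the max-norm balls with rational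
    centre and rational radius that it contains. *)
Lemma leb_open_measurable (U : set 'rV[R]_d) :
  open U -> measurable (U : set (leb_space R d)).
Proof.
move=> oU.
pose bl (qr : 'rV[rat]_d * rat) : set 'rV[R]_d :=
  [set x | forall j, `|ratr (qr.1 ord0 j) - x ord0 j| < ratr qr.2].
rewrite (_ : U = \bigcup_(qr in [set qr | bl qr `<=` U]) bl qr); last first.
  apply/seteqP; split=> [x Ux|x [qr /= + blx]]; last exact.
  have /nbhs_ballP[e /= e0 xeU] := open_nbhs_nbhs (conj oU Ux).
  have e20 : 0 < e / 2 by rewrite divr_gt0.
  have [r /itvP rb] := rat_in_itvoo e20.
  have r0 : 0 < ratr r :> R by rewrite rb.
  have itvx j : exists s : rat,
      ratr s \in `]x ord0 j - ratr r, x ord0 j + ratr r[.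
    by apply: rat_in_itvoo; lra.
  have [q qP] := choice itvx.
  exists (\row_j q j, r); last first.
    by move=> j /=; rewrite mxE ltr_distl; have := qP j; rewrite in_itv/=.
  move=> /= y yq; apply: xeU; split=> // i j; rewrite ord1 {i}.
  have := yq j; have := qP j; rewrite mxE in_itv/= /ball/=.
  rewrite !ltr_distl => /andP[? ?] /andP[? ?].
  have : ratr r < e / 2 by rewrite rb.
  by move=> ?; apply/andP; split; lra.
rewrite bigcup_mkcond; apply: countable_bigcupT_measurable => // qr.
case: ifPn => // _.
rewrite (_ : bl qr = [set x | forall j,
    `|(\row_j ratr (qr.1 ord0 j)) ord0 j - x ord0 j| < ratr qr.2]).
  exact: leb_ball_measurable.
by apply/seteqP; split=> x /= xq j; have := xq j; rewrite mxE.
Qed.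

Lemma continuous_leb_measurable (f : 'rV[R]_d -> R) :
  continuous f -> measurable_fun setT (f : leb_space R d -> R).
Proof.
move=> /continuousP cf.
apply: (measurability _ (RGenOInfty.measurableE R)).
move=> /= _ [_] [c] -> <-; rewrite setTI.
apply: leb_open_measurable; apply: cf; exact: interval_open.
Qed.

Lemma leb_bounded_ltey (A : set 'rV[R]_d) :
  bounded_set A -> (leb R d (A : set (leb_space R d)) < +oo)%E.
Proof.
move=> [M' [_ /(_ (M' + 1))]]; rewrite ltrDl ltr01 => /(_ isT) AM.
set M := M' + 1 in AM.
have [r r0 Ar] : exists2 r : R, 0 <= r & forall x j, A x -> `|x ord0 j| < r.
  exists (`|M| + 1) => [|x j Ax]; first by rewrite addr_ge0.
  have : mx_norm x <= M := AM x Ax.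
  have : `|x ord0 j| <= mx_norm x.
    rewrite mx_normE -[leLHS]nngE num_le.
    exact: (le_bigmax _ (fun ij => `|x ij.1 ij.2|%:nng) (ord0, j)).
  by have := ler_norm M; lra.
have Abox : A `<=` box (const_mx (- r)) (const_mx r).
  move=> x Ax j; rewrite !mxE; have := Ar _ j Ax.
  by rewrite ltr_norml => /andP[-> /ltW].
apply: (le_lt_trans (le_outer_measure (@lebesgue_outer R d) _ _ Abox)).
apply: (le_lt_trans (cover_outer_le (@box_cost_ge0 R d) _)).
apply: (@le_lt_trans _ _ (\prod_(j < d) (r - - r))%:E); last exact: ltry.
apply: ereal_inf_lbound.
exists (const_mx (- r), const_mx r) => /=.
  by split=> // j; rewrite !mxE; lra.
by congr EFin; apply: eq_bigr => j _; rewrite !mxE.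
Qed.

End lebesgue_measurability.

(** * Integrability and norms in L^p *)

Section Lp_facts.
Context {disp : measure_display} {T : measurableType disp} {R : realType}.
Variables (mu : {measure set T -> \bar R}) (p : R).
Hypothesis p1 : 1 <= p.
Implicit Types (f g : T -> R).
Notation norm f := (fine (Lnorm mu p%:E (EFin \o f%R))%E).

Lemma Lfun_measurable f : f \in Lfun mu p%:E -> measurable_fun setT f.
Proof. by rewrite inE => /andP[/[!inE]]. Qed.

Lemma Lfun_fin f : f \in Lfun mu p%:E -> ('N[mu]_p%:E[EFin \o f])%E \is a fin_num.
Proof.
rewrite inE => /andP[_]; rewrite inE/= /finite_norm => fy.
by rewrite ge0_fin_numE// Lnorm_ge0.
Qed.

Lemma Lfun_lin (a : R) f g : f \in Lfun mu p%:E -> g \in Lfun mu p%:E ->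
  (fun x => a * f x + g x) \in Lfun mu p%:E.
Proof.
move=> Lf Lg.
have p1' : (1 <= p%:E)%E by rewrite lee_fin.
exact: (@GRing.rpredD _ (Lfun mu p%:E) _ _ (@GRing.rpredZ _ _ _ a f Lf) Lg).
Qed.

Lemma LnormD_le f g : f \in Lfun mu p%:E -> g \in Lfun mu p%:E ->
  norm (fun x => f x + g x) <= norm f + norm g.
Proof.
move=> Lf Lg; rewrite -fineD ?Lfun_fin//.
have Lfg : (fun x => f x + g x) \in Lfun mu p%:E.
  by have := Lfun_lin 1 Lf Lg; under eq_fun do rewrite mul1r.
apply: fine_le; rewrite ?fin_numD ?Lfun_fin//.
by apply: eminkowski; rewrite ?lee_fin//; exact: Lfun_measurable.
Qed.

Lemma Lnorm_le f g : measurable_fun setT f -> g \in Lfun mu p%:E ->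
  (forall x, `|f x| <= `|g x|) ->
  f \in Lfun mu p%:E /\ norm f <= norm g.
Proof.
move=> mf Lg fg.
have p0 : 0 <= p by apply: le_trans p1.
have mpow (h : T -> R) : measurable_fun setT h ->
    measurable_fun setT (fun x => (`|(h x)%:E| `^ p)%E).
  move=> mh; apply: (measurableT_comp (measurable_poweR _)) => //.
  by apply: measurableT_comp => //; exact/measurable_EFinP.
have le_fg : ('N[mu]_p%:E[EFin \o f] <= 'N[mu]_p%:E[EFin \o g])%E.
  rewrite unlock; apply: gt0_ler_poweR; rewrite ?invr_ge0//.
  - by rewrite in_itv/= leey integral_ge0// => x _; exact: poweR_ge0.
  - by rewrite in_itv/= leey integral_ge0// => x _; exact: poweR_ge0.
  apply: ge0_le_integral => //.
  - by move=> x _; exact: poweR_ge0.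
  - exact: mpow.
  - by apply: mpow; exact: Lfun_measurable.
  - move=> x _; apply: gt0_ler_poweR => //; last by rewrite lee_fin.
    + by rewrite in_itv/= leey andbT lee_fin.
    + by rewrite in_itv/= leey andbT lee_fin.
have Lf : f \in Lfun mu p%:E.
  rewrite inE; apply/andP; split; rewrite inE//=.
  by apply: (le_lt_trans le_fg); move: Lg; rewrite inE => /andP[_]; rewrite inE.
by split=> //; apply: fine_le => //; exact: Lfun_fin.
Qed.

Lemma Lnorm_eq0_ae f : f \in Lfun mu p%:E -> norm f = 0 ->
  ae_eq mu setT f (cst 0).
Proof.
move=> Lf f0.
have : (EFin \o f) = \0%E %[ae mu].
  apply: (@Lnorm_eq0_eq0 _ _ _ _ _ p%:E).
  - by apply/measurable_EFinP; exact: Lfun_measurable.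
  - by rewrite lte_fin (lt_le_trans ltr01).
  - by rewrite -(fineK (Lfun_fin Lf)) f0.
by apply: filterS => x /= /(_ Logic.I)[].
Qed.

(** Comparison of exponent 1 with exponent [p], which makes L^p functions
    locally integrable. *)
Lemma le_1D_powR (y : R) : 0 <= y -> y <= 1 + y `^ p.
Proof.
move=> y0; have [y1|/ltW y1] := leP y 1.
  by rewrite (le_trans y1)// lerDl powR_ge0.
by rewrite (le_trans (le1r_powR y1 p1))// lerDr.
Qed.

(** The majorant is M (1_K + |f|^p), by [le_1D_powR] on [K]; it serves p = 1 and
    p > 1 alike. *)
Lemma Lfun_mul_integrable f (psi : T -> R) (K : set T) (M : R) :
  f \in Lfun mu p%:E -> measurable_fun setT psi ->
  measurable K -> (mu K < +oo)%E ->
  (forall x, `|psi x| <= M) -> (forall x, ~ K x -> psi x = 0) ->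
  mu.-integrable setT (EFin \o (fun x => f x * psi x)).
Proof.
move=> Lf mpsi mK Kfin psiM psi0.
have int1 : mu.-integrable setT (EFin \o (\1_K : T -> R)).
  apply/integrableP; split; first exact/measurable_EFinP/measurable_indic.
  under eq_integral do rewrite /= ger0_norm//.
  by rewrite integral_indic// setIT.
have := integrableZl measurableT M (integrableD measurableT int1
  (Lfun_integrable p1 Lf)).
apply: le_integrable => //.
  by apply/measurable_EFinP/measurable_funM => //; exact: Lfun_measurable.
move=> x _ /=; rewrite lee_fin normrM.
have M0 : 0 <= M by apply: le_trans (psiM x).
rewrite [leRHS]ger0_norm; last first.
  by rewrite mulr_ge0// addr_ge0// powR_ge0.
rewrite indicE; have [Kx|Kx] := pselect (K x).
  rewrite mem_set// mulrC ler_pM//.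
  by rewrite le_1D_powR.
by rewrite psi0// normr0 mulr0 mulr_ge0// addr_ge0// powR_ge0.
Qed.

End Lp_facts.

(** * Minkowski's inequality for finite sums *)

(** With A and B the norms of [a] and [b], (a + b) / (A + B) is a convex
    combination of a / A and b / B with weights A / (A + B) and B / (A + B);
    the claim is convexity of the [p]-th power, summed over the entries. *)
Lemma lp_sum_minkowski {R : realType} (I : finType) (p : R) (a b : I -> R) :
  1 <= p -> (forall i, 0 <= a i) -> (forall i, 0 <= b i) ->
  (\sum_i (a i + b i) `^ p) `^ p^-1 <=
  (\sum_i a i `^ p) `^ p^-1 + (\sum_i b i `^ p) `^ p^-1.
Proof.
move=> p1 a0 b0.
have p_gt0 : 0 < p by apply: lt_le_trans p1.
have pN0 : p != 0 by rewrite gt_eqF.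
have sum0 (c : I -> R) : 0 <= \sum_i c i `^ p.
  by apply: sumr_ge0 => i _; exact: powR_ge0.
have [N NE] : exists N : (I -> R) -> R, forall c, N c = (\sum_i c i `^ p) `^ p^-1.
  by eexists.
have N0 c : 0 <= N c by rewrite NE powR_ge0.
have N_pow c : N c `^ p = \sum_i c i `^ p by rewrite NE -powRrM mulVf// powRr1.
have zero_case c e : (forall i, 0 <= c i) -> N c = 0 ->
    \sum_i (c i + e i) `^ p = \sum_i e i `^ p.
  move=> c0 Nc; have := N_pow c; rewrite Nc powR0// => /esym/eqP.
  rewrite psumr_eq0 => [/allP cz|i _]; last exact: powR_ge0.
  apply: eq_bigr => i _.
  have /implyP/(_ isT)/eqP/powR_eq0_eq0 -> := cz i (mem_index_enum _).
  by rewrite add0r.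
rewrite -(NE a) -(NE b).
have [Az|AN0] := eqVneq (N a) 0; first by rewrite Az add0r zero_case// NE.
have [Bz|BN0] := eqVneq (N b) 0.
  by under eq_bigr do rewrite addrC; rewrite Bz addr0 zero_case// NE.
have A_gt0 : 0 < N a by rewrite lt_neqAle eq_sym AN0 N0.
have B_gt0 : 0 < N b by rewrite lt_neqAle eq_sym BN0 N0.
have normalized c : (forall i, 0 <= c i) -> N c != 0 ->
    \sum_i (c i / N c) `^ p = 1.
  move=> c0 cN0; under eq_bigr do rewrite powRM ?invr_ge0//.
  rewrite -mulr_suml -N_pow -powRM ?invr_ge0// divff//.
  by rewrite powR1.
have := normalized _ a0 AN0; have := normalized _ b0 BN0.
move: (N a) (N b) A_gt0 B_gt0 => A B A_gt0 B_gt0 normB normA.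
have AB_gt0 : 0 < A + B by rewrite addr_gt0.
pose t := A / (A + B).
have t0 : 0 <= t by rewrite divr_ge0// ltW.
have t1 : t <= 1 by rewrite ler_pdivrMr// mul1r lerDl ltW.
have onemt : 1 - t = B / (A + B) by rewrite /t; field; rewrite gt_eqF.
have termwise i : (a i + b i) `^ p <=
    (A + B) `^ p * (t * (a i / A) `^ p + (1 - t) * (b i / B) `^ p).
  have aA : 0 <= a i / A by rewrite divr_ge0// ltW.
  have bB : 0 <= b i / B by rewrite divr_ge0// ltW.
  have -> : a i + b i = (A + B) * (t * (a i / A) + (1 - t) * (b i / B)).
    by rewrite onemt /t; field; rewrite !gt_eqF.
  rewrite powRM ?(ltW AB_gt0)//; last first.
    by rewrite addr_ge0// mulr_ge0// subr_ge0.
  rewrite ler_wpM2l ?powR_ge0//.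
  by apply: (convex_powR p1 (Itv01 t0 t1)); rewrite inE/= in_itv/= andbT.
apply: (@le_trans _ _ (((A + B) `^ p) `^ p^-1)).
  apply: ge0_ler_powR; rewrite ?nnegrE ?powR_ge0 ?sum0 ?invr_ge0 ?(ltW p_gt0)//.
  apply: (le_trans (ler_sum _ (fun i _ => termwise i))).
  rewrite -mulr_sumr big_split/= -!mulr_sumr normA normB.
  by rewrite !mulr1 subrKC mulr1.
by rewrite -powRrM divff// powRr1// ltW.
Qed.

(** * Weak derivatives *)

Section weak_derivatives.
Context {R : realType} {d : nat}.
Notation Rd := 'rV[R]_d.
Implicit Types (D K : set Rd) (f g w v phi : Rd -> R) (s : seq 'I_d).

Lemma restrictE D f x : (f \_ D) x = if x \in D then f x else 0.
Proof. by []. Qed.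

Lemma restrict_lin D (a : R) w v :
  (fun x => a * w x + v x) \_ D = (fun x => a * (w \_ D) x + (v \_ D) x).
Proof.
apply/funext => x; rewrite !restrictE; case: ifP => // _.
by rewrite mulr0 addr0.
Qed.

Lemma restrict_id D f : (f \_ D) \_ D = f \_ D.
Proof. by apply/funext => x; rewrite !restrictE; case: (x \in D). Qed.

Lemma Rd_compact_closed K : compact K -> closed K.
Proof. by apply: compact_closed; exact: norm_hausdorff. Qed.

(** Off the closed set [K] the function vanishes on a neighbourhood, so its
    difference quotients vanish too. *)
Lemma partials_off_support K phi s x : closed K ->
  (forall y, ~ K y -> phi y = 0) -> ~ K x -> partials s phi x = 0.
Proof.
move=> clK phi0; elim: s x => [|i s IH] x Kx; first exact: phi0.
rewrite /= -[RHS](@derive_cst R Rd R^o 0 x (delta_mx ord0 i)).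
apply: near_eq_derive; have := open_nbhs_nbhs (conj (closed_openC clK) Kx).
by apply: filterS => y; exact: IH.
Qed.

(** Derivatives of test functions are continuous with compact support, hence
    bounded, measurable and carried by a set of finite measure. *)
Lemma test_mul_integrable (p : R) D D' f phi s : 1 <= p ->
  Lp p D f -> test_function D' phi ->
  (leb R d).-integrable setT
    (EFin \o (fun x => (f \_ D) x * partials s phi x)).
Proof.
move=> p1 Lf [smooth_phi [K [cK _ phi0]]].
have clK := Rd_compact_closed cK.
have cpsi : continuous (partials s phi) by have [] := smooth_phi s.
have psi0 x : ~ K x -> partials s phi x = 0.
  by move=> Kx; exact: (partials_off_support s clK phi0 Kx).
have mK : measurable (K : set (leb_space R d)).
  rewrite -[K]setCK; apply: measurableC; apply: leb_open_measurable.
  exact: closed_openC.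
have [M psiM] : exists M, forall x, `|partials s phi x| <= M.
  have /compact_bounded[M [_ /(_ (M + 1))]] :
      compact (partials s phi @` K : set R^o).
    by apply: continuous_compact => //; exact: continuous_subspaceT.
  rewrite ltrDl ltr01 => /(_ isT) KM.
  exists `|M + 1| => x; have [Kx|Kx] := pselect (K x).
    by apply: (le_trans (KM (partials s phi x) _)); [exists x|exact: ler_norm].
  by rewrite psi0// normr0.
apply: (Lfun_mul_integrable p1 Lf (continuous_leb_measurable cpsi) mK _ psiM)
  => //.
exact/leb_bounded_ltey/compact_bounded.
Qed.

(** Moving the restriction to the first factor turns pairings over [D] into
    integrals over the whole space of a product of globally defined
    functions. *)
Lemma pairing_restrict D f psi : \int[leb R d]_(x in D) (f x * psi x) =
  \int[leb R d]_x ((f \_ D) x * psi x).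
Proof.
rewrite Rintegral_mkcond; apply: eq_Rintegral => x _.
by rewrite !restrictE; case: ifP => //; rewrite mul0r.
Qed.

Lemma pairing_lin (p : R) D D' (a : R) f g phi s : 1 <= p ->
  Lp p D f -> Lp p D g -> test_function D' phi ->
  \int[leb R d]_(x in D) ((a * f x + g x) * partials s phi x) =
  a * (\int[leb R d]_(x in D) (f x * partials s phi x)) +
  \int[leb R d]_(x in D) (g x * partials s phi x).
Proof.
move=> p1 Lf Lg tphi; rewrite (pairing_restrict D (fun x => a * f x + g x)).
rewrite (pairing_restrict D f) (pairing_restrict D g).
have If := test_mul_integrable s p1 Lf tphi.
have Ig := test_mul_integrable s p1 Lg tphi.
rewrite -RintegralZl// -RintegralD//; last first.
  exact: (integrableZl measurableT a If).
by apply: eq_Rintegral => x _; rewrite restrict_lin mulrDl mulrA.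
Qed.

Lemma weak_derivative_lin (k : nat) (alpha : multi_index k) (p : R) D (a : R)
    f1 f2 g1 g2 : 1 <= p ->
  Lp p D f1 -> Lp p D f2 -> Lp p D g1 -> Lp p D g2 ->
  weak_derivative alpha D f1 g1 -> weak_derivative alpha D f2 g2 ->
  weak_derivative alpha D (fun x => a * f1 x + f2 x)
                          (fun x => a * g1 x + g2 x).
Proof.
move=> p1 Lf1 Lf2 Lg1 Lg2 w1 w2 phi tphi.
rewrite (pairing_lin a _ p1 Lf1 Lf2 tphi).
rewrite (pairing_lin a [::] p1 Lg1 Lg2 tphi)/=.
by rewrite mulrDr [X in _ = X + _]mulrCA -w1// -w2.
Qed.

(** A test function on [D] is a test function on the whole space, and its
    derivatives vanish off [D]. *)
Lemma weak_derivative_restrict (k : nat) (alpha : multi_index k) D f g :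
  weak_derivative alpha setT f g ->
  weak_derivative alpha D (f \_ D) (g \_ D).
Proof.
move=> fg phi [smooth_phi [K [cK KD phi0]]].
have tphi : test_function setT phi by split=> //; exists K.
have := fg phi tphi.
rewrite (pairing_restrict setT f) (pairing_restrict setT g).
rewrite (pairing_restrict D (f \_ D)) (pairing_restrict D (g \_ D)).
have integral_restrict (h psi : Rd -> R) : (forall x, ~ K x -> psi x = 0) ->
    \int[leb R d]_x ((h \_ setT) x * psi x) =
    \int[leb R d]_x (((h \_ D) \_ D) x * psi x).
  move=> psi0; apply: eq_Rintegral => x _.
  rewrite restrict_id !restrictE in_setT; case: ifPn => // /negP xD.
  by rewrite psi0 ?mulr0// => Kx; apply/xD/mem_set/KD.
have cl := Rd_compact_closed cK.
rewrite (integral_restrict f (mderiv alpha phi)).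
  by rewrite (integral_restrict g phi).
by move=> x Kx; exact: (partials_off_support _ cl phi0 Kx).
Qed.

End weak_derivatives.

(** * Infima of sets of nonnegative numbers *)

Section nonneg_inf.
Context {R : realType}.
Implicit Types (S : set R).

Lemma inf_ge0 S : (forall x, S x -> 0 <= x) -> 0 <= inf S.
Proof.
move=> S0; have [->|/set0P Sn] := eqVneq S set0; first by rewrite inf0.
by apply: lb_le_inf => // x; exact: S0.
Qed.

Lemma inf_le_mem S x : (forall y, S y -> 0 <= y) -> S x -> inf S <= x.
Proof. by move=> S0 Sx; apply: ge_inf => //; exists 0 => y; exact: S0. Qed.

(** This is why an operator norm, an infimum of admissible constants, is itself
    admissible. *)
Lemma le_mul_inf S (x y : R) : S !=set0 -> 0 <= y ->
  (forall M, S M -> x <= M * y) -> x <= inf S * y.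
Proof.
move=> [M0 SM0] y0 Sxy; move: y0; rewrite le_eqVlt => /predU1P[y0|y0].
  by have := Sxy _ SM0; rewrite -y0 !mulr0.
rewrite -ler_pdivrMr//; apply: lb_le_inf; first by exists M0.
by move=> M SM; rewrite ler_pdivrMr//; exact: Sxy.
Qed.

Lemma inf_add_le S1 S2 S (S0 : forall x, S x -> 0 <= x) :
  S1 !=set0 -> S2 !=set0 ->
  (forall x y, S1 x -> S2 y -> exists2 z, S z & z <= x + y) ->
  inf S <= inf S1 + inf S2.
Proof.
move=> S1n S2n Sle; rewrite -lerBlDr; apply: lb_le_inf => // x S1x.
rewrite lerBlDr -lerBlDl; apply: lb_le_inf => // y S2y; rewrite lerBlDl.
by have [z Sz] := Sle x y S1x S2y; apply: le_trans; exact: inf_le_mem.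
Qed.

End nonneg_inf.

(** * The Sobolev space W^{k,p} *)

Section sobolev_space.
Context {R : realType} {d : nat} (k : nat) (p : R).
Hypothesis p1 : 1 <= p.
Notation Rd := 'rV[R]_d.
Implicit Types (D : set Rd) (f w v : Rd -> R).
Implicit Types (g gw gv : multi_index (d := d) k -> Rd -> R).

Definition family_norm D g : R := (\sum_alpha (Lp_norm p D (g alpha)) `^ p) `^ p^-1.

Lemma Lp_norm_ge0 D f : 0 <= Lp_norm p D f.
Proof. by rewrite /Lp_norm fine_ge0// Lnorm_ge0. Qed.

Lemma Lp_lin D (a : R) w v : Lp p D w -> Lp p D v ->
  Lp p D (fun x => a * w x + v x).
Proof. by move=> Lw Lv; rewrite /Lp restrict_lin; exact: Lfun_lin. Qed.

Lemma Lp_normD D w v : Lp p D w -> Lp p D v ->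
  Lp_norm p D (fun x => w x + v x) <= Lp_norm p D w + Lp_norm p D v.
Proof.
move=> Lw Lv; rewrite /Lp_norm.
have -> : (fun x => w x + v x) \_ D = (fun x => (w \_ D) x + (v \_ D) x).
  by apply/funext => x; rewrite !restrictE; case: ifP => // _; rewrite addr0.
exact: (LnormD_le p1 Lw Lv).
Qed.

Lemma Lp_restrict D f : open D -> Lp p setT f ->
  Lp p D (f \_ D) /\ Lp_norm p D (f \_ D) <= Lp_norm p setT f.
Proof.
rewrite /Lp /Lp_norm restrict_id => oD.
have -> : f \_ setT = f by apply/funext => x; rewrite /patch in_setT.
move=> Lf; apply: (Lnorm_le p1 _ Lf) => [|x].
  apply/(measurable_restrictT _ (leb_open_measurable oD)).
  exact/measurable_funTS/(Lfun_measurable Lf).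
by rewrite restrictE; case: ifP => _; rewrite ?lexx ?normr0.
Qed.

(** A family of weak derivatives contains the function itself, at the zero
    multi-index. *)
Lemma exists_mi_order0 : exists alpha : multi_index (d := d) k, mi_order alpha = 0%N.
Proof.
pose z : {ffun 'I_d -> 'I_k.+1} := [ffun=> ord0].
have z0 : (\sum_i z i = 0)%N by rewrite big1// => i _; rewrite ffunE.
have zk : (\sum_i z i <= k)%N by rewrite z0.
by exists (exist (fun a : {ffun 'I_d -> 'I_k.+1} => \sum_i a i <= k)%N z zk).
Qed.

Lemma weak_derivatives_Lp D v g : weak_derivatives p D v g -> Lp p D v.
Proof.
by move=> Dv; have [a a0] := exists_mi_order0; have [L _ /(_ a0) <-] := Dv a.
Qed.

Lemma Lp_norm_le_family D v g : weak_derivatives p D v g ->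
  Lp_norm p D v <= family_norm D g.
Proof.
move=> Dv; have [a a0] := exists_mi_order0.
have p_gt0 : 0 < p by apply: lt_le_trans p1.
have <- : g a = v by have [_ _ ->] := Dv a.
rewrite -[leLHS]powRr1 ?Lp_norm_ge0// -(divff (lt0r_neq0 p_gt0)) powRrM.
have rest_ge0 : 0 <= \sum_(b | b != a) Lp_norm p D (g b) `^ p.
  by apply: sumr_ge0 => b _; exact: powR_ge0.
rewrite /family_norm (bigD1 a)//=.
apply: ge0_ler_powR; rewrite ?nnegrE ?invr_ge0 ?powR_ge0 ?(ltW p_gt0)//.
- by rewrite addr_ge0// powR_ge0.
- by rewrite lerDl.
Qed.

Lemma weak_derivatives_lin D (a : R) w v gw gv :
  weak_derivatives p D w gw -> weak_derivatives p D v gv ->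
  weak_derivatives p D (fun x => a * w x + v x)
    (fun (alpha : multi_index k) x => a * gw alpha x + gv alpha x).
Proof.
move=> Dw Dv alpha; have [Lw Ww w0] := Dw alpha; have [Lv Wv v0] := Dv alpha.
have Lw0 := weak_derivatives_Lp Dw; have Lv0 := weak_derivatives_Lp Dv.
split; first exact: Lp_lin.
- exact: (weak_derivative_lin a p1 Lw0 Lv0 Lw Lv).
- by move=> a0; rewrite w0// v0.
Qed.

Lemma weak_derivatives_restrict D v g : open D ->
  weak_derivatives p setT v g ->
  weak_derivatives p D (v \_ D) (fun alpha : multi_index k => g alpha \_ D).
Proof.
move=> oD Dv alpha; have [Lg Wg g0] := Dv alpha; split.
- exact: (Lp_restrict oD Lg).1.
- exact: weak_derivative_restrict.
- by move=> /g0 ->.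
Qed.

Lemma sobolev_lin D (a : R) w v : sobolev k p D w -> sobolev k p D v ->
  sobolev k p D (fun x => a * w x + v x).
Proof. by move=> [gw Dw] [gv Dv]; eexists; exact: weak_derivatives_lin Dw Dv. Qed.

Lemma family_norm_ge0 D g : 0 <= family_norm D g.
Proof. exact: powR_ge0. Qed.

Lemma le_family_norm D D' g g' :
  (forall alpha, Lp_norm p D (g alpha) <= Lp_norm p D' (g' alpha)) ->
  family_norm D g <= family_norm D' g'.
Proof.
move=> gg'; have p0 : 0 <= p by apply: le_trans p1.
apply: ge0_ler_powR; rewrite ?nnegrE ?invr_ge0 ?sumr_ge0//.
- by move=> *; exact: powR_ge0.
- by move=> *; exact: powR_ge0.
apply: ler_sum => alpha _.
by apply: ge0_ler_powR; rewrite ?nnegrE ?Lp_norm_ge0.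
Qed.

Lemma sobolev_norm_ge0 D v : 0 <= sobolev_norm k p D v.
Proof. by apply: inf_ge0 => _ [g _ <-]; exact: family_norm_ge0. Qed.

Lemma sobolev_norm_le D v g : weak_derivatives p D v g ->
  sobolev_norm k p D v <= family_norm D g.
Proof.
move=> Dv; apply: inf_le_mem; last by exists g.
by move=> _ [h _ <-]; exact: family_norm_ge0.
Qed.

(** Adding families of [w] and [v] gives a family of the sum, whose
    norm is controlled by Minkowski in L^p for each entry and then in l^p. *)
Lemma sobolev_normD D w v : sobolev k p D w -> sobolev k p D v ->
  sobolev_norm k p D (fun x => w x + v x) <=
  sobolev_norm k p D w + sobolev_norm k p D v.
Proof.
move=> [gw Dw] [gv Dv]; apply: inf_add_le.
- by move=> _ [g _ <-]; exact: family_norm_ge0.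
- by eexists; exists gw.
- by eexists; exists gv.
move=> _ _ [{Dw}gw Dw <-] [{Dv}gv Dv <-].
exists (family_norm D (fun alpha x => gw alpha x + gv alpha x)).
  exists (fun alpha x => gw alpha x + gv alpha x) => //.
  have := weak_derivatives_lin 1 Dw Dv; under eq_fun do rewrite mul1r.
  by congr weak_derivatives; apply/funext => alpha;
    apply/funext => x; rewrite mul1r.
apply: le_trans (lp_sum_minkowski p1 (fun alpha => Lp_norm_ge0 D (gw alpha))
  (fun alpha => Lp_norm_ge0 D (gv alpha))).
have p0 : 0 <= p by apply: le_trans p1.
apply: ge0_ler_powR; rewrite ?nnegrE ?invr_ge0 ?sumr_ge0//.
- by move=> *; exact: powR_ge0.
- by move=> *; exact: powR_ge0.
apply: ler_sum => alpha _.
apply: ge0_ler_powR; rewrite ?nnegrE ?addr_ge0 ?Lp_norm_ge0//.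
by apply: Lp_normD; [have [] := Dw alpha|have [] := Dv alpha].
Qed.

Lemma sobolev_restrict D v : open D -> sobolev k p setT v ->
  sobolev k p D (v \_ D).
Proof.
by move=> oD [g Dv]; eexists; exact: weak_derivatives_restrict Dv.
Qed.

(** Restricting the members of a family term by term gives a family on [D],
    whose L^p norms are no larger. *)
Lemma sobolev_norm_restrict D v : open D -> sobolev k p setT v ->
  sobolev_norm k p D (v \_ D) <= sobolev_norm k p setT v.
Proof.
move=> oD [g0 Dv0]; apply: lb_le_inf; first by eexists; exists g0.
move=> _ [g Dv <-].
apply: (le_trans (sobolev_norm_le (weak_derivatives_restrict oD Dv))).
apply: le_family_norm => alpha.
by apply: (Lp_restrict oD _).2; have [] := Dv alpha.
Qed.

(** The L^p norm of [v] is one of the entries of every family norm, so it is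
    below the infimum. *)
Lemma sobolev_norm_eq0_ae D v : sobolev k p D v -> sobolev_norm k p D v = 0 ->
  ae_eq (leb R d) D v (fun=> 0).
Proof.
move=> [g0 Dv0] v0.
have Lv : Lp p D v := weak_derivatives_Lp Dv0.
have nv : Lp_norm p D v = 0.
  apply/eqP; rewrite eq_le Lp_norm_ge0 andbT -v0.
  apply: lb_le_inf; first by eexists; exists g0.
  by move=> _ [g Dv <-]; exact: Lp_norm_le_family.
have := Lnorm_eq0_ae p1 Lv nv.
by apply: filterS => x /= /(_ Logic.I) + Dx; rewrite /patch mem_set.
Qed.

End sobolev_space.

(** * The boundary inner product *)

Section L2_dot_product.
Context {disp : measure_display} {T : measurableType disp} {R : realType}.
Variable mu : {measure set T -> \bar R}.
Implicit Types (f g h : T -> R).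
Notation L2 f := (f \in Lfun mu 2%:E).

Lemma L2_mul_integrable f g : L2 f -> L2 g ->
  mu.-integrable setT (EFin \o (fun x => f x * g x)).
Proof. by move=> Lf Lg; apply/Lfun1_integrable; exact: Lfun2_mul_Lfun1. Qed.

Lemma L2_dot_lin (a : R) f g h : L2 f -> L2 g -> L2 h ->
  \int[mu]_x ((a * f x + g x) * h x) =
  a * (\int[mu]_x (f x * h x)) + \int[mu]_x (g x * h x).
Proof.
move=> Lf Lg Lh; have Ifh := L2_mul_integrable Lf Lh.
rewrite -RintegralZl// -RintegralD//; last 2 first.
- exact: (integrableZl measurableT a Ifh).
- exact: L2_mul_integrable.
by apply: eq_Rintegral => x _; rewrite mulrDl mulrA.
Qed.

Lemma L2_dot_ae f g h : L2 f -> L2 g -> L2 h -> ae_eq mu setT f g ->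
  \int[mu]_x (f x * h x) = \int[mu]_x (g x * h x).
Proof.
move=> Lf Lg Lh fg; congr fine; apply: ae_eq_integral => //.
- exact/measurable_EFinP/(measurable_funM (Lfun_measurable Lf))/(Lfun_measurable Lh).
- exact/measurable_EFinP/(measurable_funM (Lfun_measurable Lg))/(Lfun_measurable Lh).
- by apply: filterS fg => x /= fg /fg ->.
Qed.

(** Evaluate at the minimiser - C / A; when A = 0 the form is affine in [a] and
    can stay nonnegative only if C = 0, which the value -1 at
    - (B + 1) / (2 C) shows. *)
Lemma quadratic_ge0_discr (A B C : R) : 0 <= A -> 0 <= B ->
  (forall a, 0 <= a ^+ 2 * A + 2 * a * C + B) ->
  `|C| <= Num.sqrt A * Num.sqrt B.
Proof.
move=> A0 B0 quad; rewrite -sqrtrM// -sqrtr_sqr ler_wsqrtr//.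
have [Az|AN0] := eqVneq A 0.
  have [->|CN0] := eqVneq C 0; first by rewrite expr0n/= mulr_ge0.
  have := quad (- (B + 1) / (2 * C)).
  have -> : (- (B + 1) / (2 * C)) ^+ 2 * A + 2 * (- (B + 1) / (2 * C)) * C + B
      = - 1 by rewrite Az; field.
  by rewrite lerNr oppr0 ler10.
have A_gt0 : 0 < A by rewrite lt_neqAle eq_sym AN0.
have := quad (- C / A).
have -> : (- C / A) ^+ 2 * A + 2 * (- C / A) * C + B = B - C ^+ 2 / A by field.
by rewrite subr_ge0 ler_pdivrMr// mulrC.
Qed.

Lemma L2_cauchy_schwarz f g : L2 f -> L2 g ->
  `|\int[mu]_x (f x * g x)| <=
  Num.sqrt (\int[mu]_x (f x * f x)) * Num.sqrt (\int[mu]_x (g x * g x)).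
Proof.
move=> Lf Lg.
have sq_ge0 (h : T -> R) : 0 <= \int[mu]_x (h x * h x).
  by apply: Rintegral_ge0 => x _; rewrite -expr2 sqr_ge0.
apply: quadratic_ge0_discr => // a.
have Lafg : L2 (fun x => a * f x + g x) by apply: Lfun_lin => //; rewrite ler1n.
have := sq_ge0 (fun x => a * f x + g x).
rewrite L2_dot_lin//.
have swap (h h' : T -> R) : \int[mu]_x (h x * h' x) = \int[mu]_x (h' x * h x).
  by apply: eq_Rintegral => x _; rewrite mulrC.
rewrite (swap f) (swap g (fun x => a * f x + g x)) !L2_dot_lin// (swap g f).
by move=> /le_trans; apply; rewrite le_eqVlt; apply/orP; left; apply/eqP; ring.
Qed.

End L2_dot_product.

(** * Norms of forms, functionals and solution operators *)

Section form_bounds.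
Context {R : realType} {X : Type}.
Notation fun_space := (X -> R).
Implicit Types (V : set fun_space) (N : fun_space -> R).

Lemma form_norm_bound V N (B : fun_space -> fun_space -> R) w v :
  form_bounds V N B !=set0 -> 0 <= N w -> 0 <= N v -> V w -> V v ->
  `|B w v| <= form_norm V N B * N w * N v.
Proof.
move=> B_bounded Nw Nv Vw Vv; rewrite -mulrA; apply: le_mul_inf => //.
  by rewrite mulr_ge0.
by move=> M [_ /(_ w v Vw Vv)]; rewrite mulrA.
Qed.

Lemma form_norm_ge0 V N (B : fun_space -> fun_space -> R) :
  0 <= form_norm V N B.
Proof. by apply: inf_ge0 => M []. Qed.

Lemma dual_norm_ge0 V N (F : fun_space -> R) : 0 <= dual_norm V N F.
Proof. by apply: inf_ge0 => M []. Qed.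

Lemma dual_norm_le V N (F : fun_space -> R) (M : R) : 0 <= M ->
  (forall v, V v -> `|F v| <= M * N v) -> dual_norm V N F <= M.
Proof. by move=> M0 FM; apply: inf_le_mem => // y []. Qed.

Lemma operator_norm_ge0 V N (S : (fun_space -> R) -> fun_space) :
  0 <= operator_norm V N S.
Proof. by apply: inf_ge0 => M []. Qed.

Lemma inverse_operator_bound V N B (S : (fun_space -> R) -> fun_space) w :
  inverse_operator V N B S -> operator_bounds V N S !=set0 -> V w ->
  N w <= operator_norm V N S * dual_norm V N (B w).
Proof.
move=> [dualB _ invS] S_bounded Vw.
have SBw : S (B w) = w by apply: invS => //; exact: dualB.
apply: le_mul_inf => //; first exact: dual_norm_ge0.
by move=> C [_ /(_ _ (dualB w Vw))]; rewrite SBw.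
Qed.

End form_bounds.

(** * The penalized form *)

Section penalty.
Context {R : realType} {d : nat} (k : nat) (p : R) (Omega : set 'rV[R]_d).
Hypothesis p1 : 1 <= p.
Variable gamma : ('rV[R]_d -> R) -> ('rV[R]_d -> R).
Hypothesis traceg : trace_operator k p Omega gamma.
Notation V := (sobolev k p Omega).
Notation normV := (sobolev_norm k p Omega).
Variable (B : ('rV[R]_d -> R) -> ('rV[R]_d -> R) -> R) (lambda : R).
Hypotheses (bndB : bounded_bilinear V normV B) (lambda_gt0 : 0 < lambda).
Notation Bl := (penalized_form Omega gamma lambda B).

Lemma trace_dot_lin (a : R) w v z : V w -> V v -> V z ->
  bdry_dot Omega (gamma (fun x => a * w x + v x)) (gamma z) =
  a * bdry_dot Omega (gamma w) (gamma z) + bdry_dot Omega (gamma v) (gamma z).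
Proof.
have [L2g ling _ _] := traceg; move=> Vw Vv Vz.
have Vwv : V (fun x => a * w x + v x) := sobolev_lin p1 a Vw Vv.
have L2lin : bdry_L2 Omega (fun x => a * gamma w x + gamma v x).
  by apply: Lfun_lin (L2g _ Vw) (L2g _ Vv); rewrite ler1n.
rewrite /bdry_dot (L2_dot_ae (L2g _ Vwv) L2lin (L2g _ Vz) (ling a w v Vw Vv)).
exact: L2_dot_lin (L2g _ Vw) (L2g _ Vv) (L2g _ Vz).
Qed.

Lemma bdry_dot_le w v : V w -> V v ->
  `|bdry_dot Omega (gamma w) (gamma v)| <=
  bdry_norm Omega (gamma w) * bdry_norm Omega (gamma v).
Proof.
have [L2g _ _ _] := traceg; move=> Vw Vv.
exact: L2_cauchy_schwarz (L2g _ Vw) (L2g _ Vv).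
Qed.

Lemma penalized_form_linl (a : R) w v z : V w -> V v -> V z ->
  Bl (fun x => a * w x + v x) z = a * Bl w z + Bl v z.
Proof.
have [[_ linB] _] := bndB; move=> Vw Vv Vz.
by rewrite /penalized_form linB// trace_dot_lin//; ring.
Qed.

(** The trace operator, bounded by K, contributes lambda K^2. *)
Lemma penalized_form_bounded : form_bounds V normV Bl !=set0.
Proof.
have [_ [M [M0 BM]]] := bndB; have [_ _ [K traceK] _] := traceg.
exists (M + lambda * K ^+ 2); split.
  by rewrite addr_ge0// mulr_ge0 ?sqr_ge0// ltW.
move=> w v Vw Vv; rewrite /penalized_form.
apply: (le_trans (ler_normD _ _)).
rewrite -mulrA mulrDl mulrA lerD// ?BM// normrM gtr0_norm// -mulrA.
rewrite ler_wpM2l ?(ltW lambda_gt0)//.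
apply: (le_trans (bdry_dot_le Vw Vv)).
have -> : K ^+ 2 * (normV w * normV v) = (K * normV w) * (K * normV v) by ring.
by rewrite ler_pM ?sqrtr_ge0 ?traceK.
Qed.

(** By Cauchy-Schwarz and the trace inequality the square of the boundary term
    is at most c^2 B(w,w) B(v,v), and any bound M of [B] bounds its diagonal
    values. *)
Lemma penalized_form_norm_le (c : R) : 0 <= c ->
  (forall w, V w -> bdry_norm Omega (gamma w) ^+ 2 <= c * B w w) ->
  form_norm V normV Bl <= (1 + c * lambda) * form_norm V normV B.
Proof.
move=> c0 trace_le; have [_ B_bounded] := bndB.
have lambda0 := ltW lambda_gt0.
have cl0 : 0 <= 1 + c * lambda by rewrite addr_ge0// mulr_ge0.
rewrite mulrC; apply: le_mul_inf => // M [M0 BM].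
apply: inf_le_mem => [y []//|]; split; first by rewrite mulr_ge0.
move=> w v Vw Vv; rewrite /penalized_form.
have Nw := sobolev_norm_ge0 k p Omega w; have Nv := sobolev_norm_ge0 k p Omega v.
have diag z : V z -> bdry_norm Omega (gamma z) ^+ 2 <= c * (M * normV z * normV z).
  move=> Vz; apply: (le_trans (trace_le _ Vz)); rewrite ler_wpM2l//.
  exact: (le_trans (ler_norm _) (BM _ _ Vz Vz)).
have dot_le : `|bdry_dot Omega (gamma w) (gamma v)| <= c * M * normV w * normV v.
  apply: (le_trans (bdry_dot_le Vw Vv)).
  rewrite -(@ler_pXn2r _ 2)// ?nnegrE ?mulr_ge0 ?sqrtr_ge0//.
  rewrite exprMn.
  have -> : (c * M * normV w * normV v) ^+ 2 =
    (c * (M * normV w * normV w)) * (c * (M * normV v * normV v)) by ring.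
  by rewrite ler_pM ?sqr_ge0 ?diag.
apply: (le_trans (ler_normD _ _)); rewrite normrM (gtr0_norm lambda_gt0).
have -> : M * (1 + c * lambda) * normV w * normV v =
  M * normV w * normV v + lambda * (c * M * normV w * normV v) by ring.
by rewrite lerD ?BM// ler_wpM2l.
Qed.

End penalty.

(** * The consistency error *)

(** The supremum gives the bound when the norm of [v] is positive.  When it is 0
    the quotient carries no information; then [v] equals the element [z] = - v + v
    almost everywhere, and linear functionals vanish at [z]. *)
Lemma consistency_bound {R : realType} {d : nat} (k : nat) (p : R)
    (Omega : set 'rV[R]_d) Bc Fc w v (e : R) : 1 <= p ->
  linear_on (sobolev k p (exterior Omega)) (Bc w) ->
  ae_invariant k p Omega (Bc w) ->
  linear_on (sobolev k p (exterior Omega)) Fc -> ae_invariant k p Omega Fc ->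
  (consistency_error k p Omega Bc Fc w <= e%:E)%E ->
  sobolev k p (exterior Omega) v ->
  `|Bc w v - Fc v| <= e * sobolev_norm k p (exterior Omega) v.
Proof.
move=> p1 linB aeB linF aeF err_e Vv.
have Nv := sobolev_norm_ge0 k p (exterior Omega) v.
have [v0|vN0] := eqVneq (sobolev_norm k p (exterior Omega) v) 0; last first.
  rewrite -ler_pdivrMr ?lt_neqAle ?Nv ?andbT 1?eq_sym// -lee_fin.
  by apply: le_trans err_e; apply: ereal_sup_ubound; exists v.
pose z : 'rV[R]_d -> R := fun x => - 1 * v x + v x.
have Vz : sobolev k p (exterior Omega) z := sobolev_lin p1 (- 1) Vv Vv.
have vz : ae_eq (leb R d) (exterior Omega) v z.
  have := sobolev_norm_eq0_ae p1 Vv v0; apply: filterS => x vx /vx ->.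
  by rewrite /z mulN1r addNr.
rewrite (aeB _ _ Vv Vz vz) (aeF _ _ Vv Vz vz) linB// linF//.
by rewrite !mulN1r !addNr subrr normr0 v0 mulr0.
Qed.

Lemma consistency_error_ge0 {R : realType} {d : nat} (k : nat) (p : R)
    (Omega : set 'rV[R]_d) Bc Fc w v :
  sobolev k p (exterior Omega) v ->
  (0 <= consistency_error k p Omega Bc Fc w)%E.
Proof.
move=> Vv; apply: le_ereal_sup_tmp.
exists (`|Bc w v - Fc v| / sobolev_norm k p (exterior Omega) v)%:E.
  by exists v.
by rewrite lee_fin divr_ge0// sobolev_norm_ge0.
Qed.

(** * The error estimate *)

Lemma grbf_lin {R : realType} {d n : nat} (m : 'I_n -> 'rV[R]_d) C (a : R) w v :
  grbf_space m C w -> grbf_space m C v ->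
  grbf_space m C (fun x => a * w x + v x).
Proof.
move=> [cw ->] [cv ->]; exists (fun i => a * cw i + cv i).
apply/funext => x; rewrite mulr_sumr -big_split/=.
by apply: eq_bigr => i _; rewrite mulrDl mulrA.
Qed.

Theorem theorem4p1 (R : realType) (d : nat) (d_gt0 : (0 < d)%N)
  (* the Sobolev scale W^{k,p} and the domain *)
  (k : nat) (p : R) (p_ge1 : 1 <= p)
  (Omega : set 'rV[R]_d) (domOmega : bounded_domain Omega)
  (E : ('rV[R]_d -> R) -> ('rV[R]_d -> R))
  (extE : extension_operator k p Omega E)
  (gamma : ('rV[R]_d -> R) -> ('rV[R]_d -> R))
  (traceg : trace_operator k p Omega gamma)
  (* the boundary value problem and its solution *)
  (B : ('rV[R]_d -> R) -> ('rV[R]_d -> R) -> R)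
  (bndB : bounded_bilinear (sobolev k p Omega) (sobolev_norm k p Omega) B)
  (F : ('rV[R]_d -> R) -> R)
  (bndF : dual (sobolev k p Omega) (sobolev_norm k p Omega) F)
  (g : 'rV[R]_d -> R) (L2g : bdry_L2 Omega g)
  (wpB : well_posed k p Omega gamma B)
  (u : 'rV[R]_d -> R)
  (solu : unique_weak_solution k p Omega gamma B F g u)
  (* the GRBF space *)
  (n : nat) (m : 'I_n -> 'rV[R]_d) (C : 'I_n -> 'M[R]_d)
  (covC : forall i, covariance_matrix (C i))
  (Vh_sub : grbf_space m C `<=` sobolev k p setT)
  (* the generalized Galerkin problem *)
  (lambda : R) (lambda_gt0 : 0 < lambda)
  (consistent : forall v, grbf_space m C v ->
     penalized_form Omega gamma lambda B u (truncation Omega v) =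
     penalized_functional Omega gamma lambda F g (truncation Omega v))
  (Bc : ('rV[R]_d -> R) -> ('rV[R]_d -> R) -> R)
  (bilBc : bilinear_on (grbf_space m C) (sobolev k p (exterior Omega)) Bc)
  (aeBc : forall w, grbf_space m C w -> ae_invariant k p Omega (Bc w))
  (Fc : ('rV[R]_d -> R) -> R)
  (linFc : linear_on (sobolev k p (exterior Omega)) Fc)
  (aeFc : ae_invariant k p Omega Fc)
  (uh : 'rV[R]_d -> R) (uhV : grbf_space m C uh)
  (soluh : forall v, grbf_space m C v ->
     generalized_form Omega (penalized_form Omega gamma lambda B) Bc uh v =
     generalized_functional Omega
       (penalized_functional Omega gamma lambda F g) Fc v)
  (* stability: the inverse of L_h exists and is bounded *)
  (Lhinv : (('rV[R]_d -> R) -> R) -> ('rV[R]_d -> R))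
  (invLh : inverse_operator (grbf_space m C) (sobolev_norm k p setT)
     (generalized_form Omega (penalized_form Omega gamma lambda B) Bc) Lhinv)
  (bndLhinv : operator_bounds (grbf_space m C) (sobolev_norm k p setT) Lhinv
     !=set0)
  (* the restriction mapping *)
  (pih : ('rV[R]_d -> R) -> ('rV[R]_d -> R))
  (pihV : forall v, sobolev k p Omega v -> grbf_space m C (pih v)) :
  let V := sobolev k p Omega in
  let normV := sobolev_norm k p Omega in
  let Bl := penalized_form Omega gamma lambda B in
  let Ch := operator_norm (grbf_space m C) (sobolev_norm k p setT) Lhinv in
  let interp_err := normV (u \- truncation Omega (pih u)) in
  ((normV (u \- truncation Omega uh))%:E <=
     ((1 + Ch * form_norm V normV Bl) * interp_err)%:E +
     Ch%:E * consistency_error k p Omega Bc Fc (pih u))%E /\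
  (forall c : R, 0 <= c ->
     (forall w, V w -> bdry_norm Omega (gamma w) ^+ 2 <= c * B w w) ->
     form_norm V normV Bl <= (1 + c * lambda) * form_norm V normV B /\
     (1 + Ch * form_norm V normV Bl) * interp_err <=
     (1 + Ch * ((1 + c * lambda) * form_norm V normV B)) * interp_err).
Proof.
have regroup (b1 b2 b3 c1 c2 f : R) : b1 + c1 = b3 + f ->
  - b1 + b2 + (- c1 + c2) = - (b3 - b2) + (c2 - f) by lra.
have factor (a b e x : R) : x + a * (b * x + e) = (1 + a * b) * x + a * e.
  by ring.
move=> V normV Bl Ch interp_err.
have [[Vu _] _] := solu.1.
have Vpi := pihV u Vu.
have oOmega : open Omega by case: domOmega.
have oExt : open (exterior Omega) := open_interior _.
have TV w : grbf_space m C w -> V (truncation Omega w).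
  by move=> /Vh_sub; exact: sobolev_restrict.
have VpT := TV _ Vpi; have VuhT := TV _ uhV.
have N0 w : 0 <= normV w := sobolev_norm_ge0 k p Omega w.
have Ch0 : 0 <= Ch := operator_norm_ge0 _ _ _.
have interp0 : 0 <= interp_err := N0 _.
split; last first.
  move=> c c0 trace_le.
  have Bl_le := penalized_form_norm_le traceg bndB lambda_gt0 c0 trace_le.
  split; first exact: Bl_le.
  by apply: (ler_wpM2r interp0); rewrite lerD2l; exact: (ler_wpM2l Ch0).
set e_h : 'rV[R]_d -> R := fun x => - 1 * uh x + pih u x.
have Ve : grbf_space m C e_h := grbf_lin (- 1) uhV Vpi.
have Tlin : truncation Omega e_h =
    (fun x => - 1 * truncation Omega uh x + truncation Omega (pih u) x).
  exact: restrict_lin.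
have Verr : V (u \- truncation Omega (pih u)).
  have := sobolev_lin p_ge1 (- 1) VpT Vu; congr (V _).
  by apply/funext => x; rewrite /= mulN1r addrC.
have triangle : normV (u \- truncation Omega uh) <=
    interp_err + sobolev_norm k p setT e_h.
  have -> : u \- truncation Omega uh = (fun x =>
      (u \- truncation Omega (pih u)) x + truncation Omega e_h x).
    by apply/funext => x; rewrite Tlin /=; ring.
  apply: (le_trans (sobolev_normD p_ge1 Verr (TV _ Ve))); rewrite lerD2l.
  exact: (sobolev_norm_restrict p_ge1 oOmega (Vh_sub _ Ve)).
have stable := inverse_operator_bound invLh bndLhinv Ve.
have [v0 Vv0] : exists v, sobolev k p (exterior Omega) v.
  by eexists; exact: sobolev_restrict oExt (Vh_sub _ uhV).
have eps0 : (0 <= consistency_error k p Omega Bc Fc (pih u))%E.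
  exact: consistency_error_ge0 Vv0.
(* L_h e_h is the residual of the interpolant: the exact solution, through
   [consistent], and the discrete one cancel *)
have residual e : 0 <= e ->
    (consistency_error k p Omega Bc Fc (pih u) <= e%:E)%E ->
    dual_norm (grbf_space m C) (sobolev_norm k p setT)
      (generalized_form Omega Bl Bc e_h) <= form_norm V normV Bl * interp_err + e.
  move=> e0 err_e; apply: dual_norm_le => [|v Vv].
    exact: (addr_ge0 (mulr_ge0 (form_norm_ge0 _ _ _) interp0) e0).
  have VTv := TV _ Vv.
  have Vvext : sobolev k p (exterior Omega) (v \_ (exterior Omega)).
    exact: sobolev_restrict oExt (Vh_sub _ Vv).
  have Blin (a : R) w z t : V w -> V z -> V t ->
      Bl (fun x => a * w x + z x) t = a * Bl w t + Bl z t.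
    exact: (penalized_form_linl p_ge1 traceg lambda bndB a).
  have -> : generalized_form Omega Bl Bc e_h v =
      - Bl (u \- truncation Omega (pih u)) (truncation Omega v) +
      (Bc (pih u) (v \_ (exterior Omega)) - Fc (v \_ (exterior Omega))).
    have eBl : Bl (u \- truncation Omega (pih u)) (truncation Omega v) =
        Bl u (truncation Omega v) -
        Bl (truncation Omega (pih u)) (truncation Omega v).
      have := Blin (- 1) _ _ _ VpT Vu VTv.
      rewrite mulN1r [RHS]addrC => <-; congr Bl.
      by apply/funext => x; rewrite /= mulN1r addrC.
    have := soluh v Vv; rewrite eBl /generalized_form /generalized_functional.
    rewrite -(consistent v Vv) Tlin (Blin (- 1) _ _ _ VuhT VpT VTv).
    rewrite (bilBc.2 _ Vvext (- 1) uh (pih u) uhV Vpi) -/Bl.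
    by rewrite 2!mulN1r; exact: regroup.
  apply: (le_trans (ler_normD _ _)); rewrite normrN mulrDl; apply: lerD.
    have Bl_bounded := penalized_form_bounded traceg bndB lambda_gt0.
    apply: (le_trans (form_norm_bound Bl_bounded (N0 _) (N0 _) Verr VTv)).
    apply: (ler_wpM2l (mulr_ge0 (form_norm_ge0 _ _ _) (N0 _))).
    exact: (sobolev_norm_restrict p_ge1 oOmega (Vh_sub _ Vv)).
  apply: (le_trans (consistency_bound p_ge1 (bilBc.1 _ Vpi)
    (aeBc _ Vpi) linFc aeFc err_e Vvext)).
  apply: (ler_wpM2l e0).
  exact: (sobolev_norm_restrict p_ge1 oExt (Vh_sub _ Vv)).
case epsE : (consistency_error k p Omega Bc Fc (pih u)) => [e| |].
- have e0 : 0 <= e by rewrite -lee_fin -epsE.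
  have := residual e e0; rewrite epsE lexx => /(_ isT) res.
  rewrite -EFinM -EFinD lee_fin -factor; apply: (le_trans triangle).
  by rewrite lerD2l; exact: (le_trans stable (ler_wpM2l Ch0 res)).
- (* for Ch = 0 the product Ch * +oo is 0, but then e_h has norm 0 *)
  have [Ch_eq0|ChN0] := eqVneq Ch 0.
    rewrite Ch_eq0 mul0e adde0 lee_fin mul0r addr0 mul1r.
    apply: (le_trans triangle); rewrite gerDl; apply: (le_trans stable).
    by rewrite -/Ch Ch_eq0 mul0r.
  by rewrite gt0_muley ?lte_fin ?lt_neqAle 1?eq_sym ?ChN0// addey ?leey.
- by move: eps0; rewrite epsE.
Qed.
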